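(* Let $(M,d)$ be a metric tree and let $A\subseteq B$ be subsets of $M$. Then: 1. For every positive integer $n$, $\delta_n^T(A,M)\leq\delta_n^T(B,M)$. 2. The sequence $\{\delta_n^T(A,M)\}_{n\geq 1}$ is non-increasing. Here $\delta_n^T(\cdot,M)$ denotes the T$n$-width.
   Context: Metric segment: in a metric space $(M,d)$, a metric segment from $x$ to $y$ is the image of an isometric embedding $\alpha:[a,b]\to M$ of a real interval with $\alpha(a)=x$ and $\alpha(b)=y$; it is denoted $[x,y]$. Metric tree: a metric space $(M,d)$ is a metric tree if for all $x,y,z\in M$: (1) there exists a unique metric segment $[x,y]$ from $x$ to $y$; and (2) if $[x,z]\cap[z,y]=\{z\}$ then $[x,z]\cup[z,y]=[x,y]$. Betweenness: $xzy$ means $d(x,y)=d(x,z)+d(z,y)$, i.e. $z$ is between $x$ and $y$. Convexity: a subset $A$ of a metric tree $M$ is convex if $[x,y]\subseteq A$ for all $x,y\in A$. The convex hull $\mathrm{conv}(B)$ of $B\subseteq M$ is the smallest convex subset of $M$ containing $B$. T$n$-dimensional sets: for a positive integer $n$, a subset $A\subseteq M$ is T$n$-dimensional if there exist $n$ distinct points $x_1,\dots,x_n\in M$ with $A=\mathrm{conv}(x_1,\dots,x_n)$ and such that there are no pairwise distinct indices $i,j,k$ with $x_ix_jx_k$ (no point lies between two others). A set $A$ is T*$n$-dimensional if it contains a T$n$-dimensional subset but contains no T$k$-dimensional subset for any $k>n$. T$n$-width: let $\mathcal{X}_n$ be the set of T$n$-dimensional subsets of $M$. For $A\subseteq M$ and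 a positive integer $n$, $$\delta_n^T(A,M)=\inf_{X\in\mathcal{X}_n}\,\sup_{a\in A}\,\inf_{x\in X} d(a,x)\in[0,\infty].$$ If $M$ is T*$n$-dimensional, then by convention $\delta_k^T(A,M)=\delta_n^T(A,M)$ for all $k>n$. *)

(* Defs.v *)
From mathcomp Require Import all_boot all_order all_algebra.
From mathcomp Require Import all_classical all_reals all_analysis.

Set Implicit Arguments.
Unset Strict Implicit.
Unset Printing Implicit Defensive.

Import Order.TTheory GRing.Theory Num.Theory.
Local Open Scope classical_set_scope.
Local Open Scope ring_scope.

Section MetricTree.
Context {R : realType} {M : metricType R}.
Implicit Types (x y z : M) (A B X : set M) (n k : nat).

(* [alpha] is total on [R]; only its values on [a, b] matter. *)
Definition metric_segment x y (S : set M) : Prop :=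
  exists (a b : R) (alpha : R -> M),
    [/\ a <= b,
        {in `[a, b] &, forall s t, mdist (alpha s) (alpha t) = `|s - t|},
        alpha a = x, alpha b = y & S = alpha @` `[a, b]].

(* [seg x y] is meaningful only when a metric segment from [x] to [y] exists
   and is unique; the default [set0] is never used in a metric tree. *)
Definition seg x y : set M := xget set0 (metric_segment x y).

Definition between x z y : Prop := mdist x y = mdist x z + mdist z y.

Definition convex_subset A : Prop :=
  forall x y, A x -> A y -> seg x y `<=` A.

Definition conv B : set M := smallest convex_subset B.

Definition Tdim n A : Prop :=
  (0 < n)%N /\
  exists x : 'I_n -> M,
    [/\ injective x,
        A = conv (range x) &
        forall i j k : 'I_n, i != j -> j != k -> i != k ->
          ~ between (x i) (x j) (x k)].

Definition Tstardim n A : Prop :=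
  (exists X, X `<=` A /\ Tdim n X) /\
  (forall k, (n < k)%N -> ~ exists X, X `<=` A /\ Tdim k X).

Lemma Tstardim_uniq A n k : Tstardim n A -> Tstardim k A -> n = k.
Proof.
move=> [An An'] [Ak Ak']; case: (ltngtP n k) => // h.
- by case: (An' _ h).
- by case: (Ak' _ h).
Qed.

Definition pt_dist x X : \bar R := ereal_inf [set (mdist x y)%:E | y in X].

(* The supremum is taken in [0, +oo], where the supremum of the empty set is 0,
   whereas [ereal_sup set0 = -oo]. *)
Definition deviation A X : \bar R :=
  Order.max 0%E (ereal_sup [set pt_dist a X | a in A]).

Definition raw_Twidth n A : \bar R :=
  ereal_inf [set deviation A X | X in Tdim n].

(* [Twidth k A] is [raw_Twidth n A] if the whole space is T*n-dimensional for
   some [n < k] (such an [n] is unique by [Tstardim_uniq]), and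
   [raw_Twidth k A] otherwise. *)
Definition Twidth k A : \bar R :=
  raw_Twidth (xget k [set n | (n < k)%N /\ Tstardim n setT]) A.

End MetricTree.

Definition metric_tree {R : realType} (M : metricType R) : Prop :=
  (forall x y : M, exists! S : set M, metric_segment x y S) /\
  (forall x y z : M,
     seg x z `&` seg z y = [set z] -> seg x z `|` seg z y = seg x y).

(* Main.v *)
(** The tree axioms yield the tripod property [x, y] <= [x, z] U [z, y]: the
    segments from z to x and to y agree up to a last common point w, and
    [x, w], [w, y] then meet only in w, so that they concatenate to [x, y].

    The tripod property gives an exchange argument.  Let T be a finite set none
    of whose points lies between two others, and x a point outside all segments
    between points of T.  Either T + {x} still has this property, or x can
    replace some t in T; in both cases the hull grows.  Hence if sets of
    dimension n exist and m < n, the m generators of any Tm-dimensional X lie in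
    the hull of an admissible T with at least n points.  Rooting T at one of its
    points t0, every generator lies in a segment [t0, t], so m + 1 <= n points
    of T suffice, and X lies in a Tn-dimensional set. *)

Require Import Defs.
From mathcomp Require Import all_boot all_order all_algebra.
From mathcomp Require Import all_classical all_reals all_analysis.
From mathcomp Require Import lra.

Local Open Scope classical_set_scope.

(** * Betweenness, branching points and the tripod property *)

Section Betweenness.
Set Implicit Arguments.
Unset Strict Implicit.
Import Order.TTheory GRing.Theory Num.Theory.
Local Open Scope ring_scope.
Context {R : realType} {M : metricType R}.
Implicit Types (x y z w p : M) (S : set M).

Lemma between_sym x z y : between x z y -> between y z x.
Proof.
by rewrite /between (metric_sym y x) (metric_sym y z) (metric_sym z x) addrC.
Qed.

Lemma between_refl x y : between x x y.
Proof. by rewrite /between mdistxx add0r. Qed.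

Lemma between_same x z : between x z x -> z = x.
Proof.
rewrite /between mdistxx (metric_sym z x) => h; apply/esym/mdist_positivity.
have := mdist_ge0 x z; lra.
Qed.

Lemma between_trans x z w y : between x z y -> between x w z -> between x w y.
Proof.
rewrite /between => h1 h2.
have := metric_triangle w z y; have := metric_triangle x w y; lra.
Qed.

Lemma metric_segment_between x y S z :
  metric_segment x y S -> S z -> between x z y.
Proof.
case=> a [b [alpha [ab iso <- <- ->]]] [c cab <-].
move: (cab); rewrite /= in_itv /= => /andP[ac cb].
rewrite /between !iso ?in_itv /= ?lexx ?ab //.
rewrite !ler0_norm; lra.
Qed.

Hypothesis hM : metric_tree M.

Lemma metric_segment_seg x y : metric_segment x y (seg x y).
Proof.
by case: hM => /(_ x y)[S [hS _]] _; apply: xgetPex; exists S.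
Qed.

(** Conversely, if [z] is between [x] and [y], the triangle inequality forces [[x, z]] and [[z, y]]
    to meet only in [z], so the second tree axiom puts [z] on [[x, y]]. *)
Lemma segP x y z : seg x y z <-> between x z y.
Proof.
split=> [|hz]; first exact: metric_segment_between (metric_segment_seg x y).
have ends (u v : M) : seg u v u /\ seg u v v.
  case: (metric_segment_seg u v) => a [b [alpha [ab _ <- <- ->]]].
  by split; [exists a|exists b] => //; rewrite /= in_itv /= lexx ab.
case: hM => _ /(_ x y z) <-; first by left; case: (ends x z).
apply/seteqP; split=> [q [h1 h2]|_ ->]; last first.
  by split; [case: (ends x z)|case: (ends z y)].
have := metric_segment_between (metric_segment_seg _ _) h1.
have := metric_segment_between (metric_segment_seg _ _) h2.
move: hz; rewrite /between => hz h2' h1'; apply: mdist_positivity.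
have := metric_triangle x q y; have := mdist_ge0 q z.
rewrite (metric_sym z q) in h2'; lra.
Qed.

(** Both points lie on the one segment [[x, y]], which is isometric to a real interval. *)
Lemma mdist_between x y z w : between x z y -> between x w y ->
  mdist z w = `|mdist x z - mdist x w|.
Proof.
move=> /segP + /segP.
case: (metric_segment_seg x y) => a [b [alpha [ab iso <- _ ->]]].
move=> [s sab <-] [t tab <-]; rewrite !iso //= ?in_itv /= ?lexx //.
move: sab tab; rewrite /= !in_itv /= => /andP[as_ sb] /andP[at_ tb].
have -> : `|a - s| = s - a by rewrite ler0_norm; lra.
have -> : `|a - t| = t - a by rewrite ler0_norm; lra.
by congr (`|_|); lra.
Qed.

Lemma between_eq x y z w : between x z y -> between x w y ->
  mdist x z = mdist x w -> z = w.
Proof.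
move=> hz hw e; apply: mdist_positivity.
by rewrite (mdist_between hz hw) e subrr normr0.
Qed.

Lemma between_exists x y (r : R) : 0 <= r <= mdist x y ->
  exists2 z, between x z y & mdist x z = r.
Proof.
have : forall z, seg x y z -> between x z y by move=> z /segP.
case: (metric_segment_seg x y) => a [b [alpha [ab iso <- <- ->]]] bt.
rewrite !iso ?in_itv /= ?lexx ?ab // ler0_norm ?subr_le0 //.
move=> /andP[r0 rd].
have h : a + r \in `[a, b] by rewrite in_itv /=; lra.
exists (alpha (a + r)); first by apply: bt; exists (a + r).
by rewrite iso ?in_itv /= ?lexx ?ab // distrC addrAC subrr add0r ger0_norm.
Qed.

Lemma branching_point z x y :
  exists w, [/\ between z w x, between z w y & between x w y].
Proof.
(* [E] collects the distances from [z] to the common points of [[z, x]] and [[z, y]]; the branching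
   point sits at distance [sup E]. *)
pose E : set R :=
  [set r | exists w, [/\ between z w x, between z w y & mdist z w = r]].
have E0 : E 0 by exists z; split; [exact: between_refl..|exact: mdistxx].
have Ele r : E r -> r <= mdist z x /\ r <= mdist z y.
  move=> [w [+ + <-]]; rewrite /between.
  by have := mdist_ge0 w x; have := mdist_ge0 w y; lra.
have hubE : has_ubound E by exists (mdist z x) => r /Ele[].
have supE : has_sup E by split => //; exists 0.
have s0 : 0 <= sup E by exact: ub_le_sup.
have sx : sup E <= mdist z x by apply: ge_sup => [|r /Ele[]]; first exists 0.
have sy : sup E <= mdist z y by apply: ge_sup => [|r /Ele[]]; first exists 0.
have [|w wx dw] := @between_exists z x (sup E); first by rewrite s0.
have [|w' wy dw'] := @between_exists z y (sup E); first by rewrite s0.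
(* The points at distance [sup E] on the two segments coincide: a common point [v] at distance above
   [sup E - e / 2] is within [e / 2] of each. *)
have ww' : w = w'.
  apply: mdist_positivity; apply/eqP; rewrite eq_le mdist_ge0 andbT.
  apply/ler_addgt0Pl => e e0; rewrite addr0.
  have [||r [v [vx vy dv]] re] := @sup_adherent _ E (e / 2) => //; first lra.
  have rs : r <= sup E by apply: ub_le_sup => //; exists v.
  have := metric_triangle w v w'; rewrite (mdist_between wx vx).
  rewrite (mdist_between vy wy) dw dw' dv => h; apply: le_trans h _.
  by rewrite ger0_norm ?ler0_norm; lra.
subst w'; exists w; split => //.
apply/segP; case: hM => _ /(_ x y w) <-.
  by left; apply/segP/between_sym/between_refl.
(* A point [p] of both [[x, w]] and [[w, y]] is common to [[z, x]] and [[z, y]], so it is no farther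
   from [z] than [w]; lying beyond [w], it is [w]. *)
apply/seteqP; split=> [p [/segP px /segP py]|_ ->]; last first.
  by split; apply/segP; [apply/between_sym|]; apply: between_refl.
have zpx : between z p x.
  by apply/between_sym/(between_trans (between_sym wx)).
have zpy : between z p y.
  apply: between_sym; apply: between_trans (between_sym wy) _.
  exact: between_sym.
have wp : mdist z p <= sup E by apply: ub_le_sup => //; exists p.
apply: (between_eq zpx wx); apply/eqP; rewrite dw eq_le wp /=.
move: (zpx) wx px; rewrite /between (metric_sym x w) (metric_sym x p).
by rewrite (metric_sym p w); have := mdist_ge0 w p; lra.
Qed.

(** The branching point [w] seen from [c] cuts [[a, b]] into two halves, which are end pieces of
    [[a, c]] and [[b, c]]. *)
Lemma between_tripod p a b c :
  between a p b -> between a p c \/ between b p c.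
Proof.
move=> /segP apb; have [w [wa wb awb]] := branching_point c a b.
case: (hM) => _ /(_ a b w) h.
move: apb; rewrite -h; last first.
  apply/seteqP; split=> [q [/segP aq /segP qb]|_ ->]; last first.
    by split; apply/segP; [apply/between_sym|]; apply: between_refl.
  apply: mdist_positivity; move: aq qb awb; rewrite /between.
  have := metric_triangle a q b; have := mdist_ge0 q w.
  by rewrite (metric_sym w q); lra.
case=> /segP hp; [left|right].
  exact: between_trans (between_sym wa) hp.
exact: between_trans (between_sym wb) (between_sym hp).
Qed.

End Betweenness.

(** * Independent generators and the exchange argument *)

Section Independence.
Set Implicit Arguments.
Unset Strict Implicit.
Import Order.TTheory GRing.Theory Num.Theory.
Local Open Scope ring_scope.
Context {R : realType} {M : metricType R}.
Implicit Types (x y z p t : M) (s S T U : seq M) (A X : set M) (n k : nat).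

Definition independent T : Prop :=
  forall a b c, a \in T -> b \in T -> c \in T ->
    a != b -> b != c -> a != c -> ~ between a b c.

(** Stands in for the convex hull: membership yields two explicit endpoints, to which the tripod
    property applies. *)
Definition segment_hull T : set M :=
  [set p | exists a b, [/\ a \in T, b \in T & between a p b]].

Lemma independent_sub U T : {subset U <= T} -> independent T -> independent U.
Proof. by move=> UT iT a b c /UT aT /UT bT /UT cT; exact: iT. Qed.

Lemma mem_segment_hull T t : t \in T -> segment_hull T t.
Proof. by move=> tT; exists t, t; split => //; exact: between_refl. Qed.

Lemma segment_hullS U T : {subset U <= T} -> segment_hull U `<=` segment_hull T.
Proof. by move=> UT p [a [b [/UT aT /UT bT apb]]]; exists a, b. Qed.

(** Duplicate-free sequences replace injections from ['I_n], since the exchange argument adds and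
    removes single points. *)
Lemma TdimP n A : Tdim n A <-> (0 < n)%N /\
  exists T, [/\ uniq T, size T = n, independent T & A = Defs.conv [set` T]].
Proof.
split=> -[n0 H]; split=> //.
  case: H => x [xinj -> xind]; exists (codom x); split.
  - by apply/injectiveP.
  - by rewrite size_codom card_ord.
  - move=> _ _ _ /codomP[i ->] /codomP[j ->] /codomP[k ->].
    rewrite !(inj_eq xinj); exact: xind.
  - congr Defs.conv; apply/seteqP; split=> [_ [i _ <-]|y /codomP[i ->]].
      exact: codom_f.
    by exists i.
case: H => T [uT sT iT ->]; rewrite -sT.
have tinj : injective (tnth (in_tuple T)) by exact/tuple_uniqP.
exists (tnth (in_tuple T)); split=> //.
- congr Defs.conv; apply/seteqP; split=> [y yT|_ [i _ <-]]; last exact: mem_tnth.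
  by have /tnthP[i ->] : y \in in_tuple T by []; exists i.
- move=> i j k ij jk ik; apply: iT; try exact: mem_tnth.
  all: by rewrite (inj_eq tinj).
Qed.

Lemma subset_of_size U T n : uniq T -> {subset U <= T} ->
  (size U <= n <= size T)%N ->
  exists V, [/\ uniq V, size V = n, {subset U <= V} & {subset V <= T}].
Proof.
move=> uT UT /andP[Un nT].
(* [W] reorders [T] with the points of [U] first, so its prefix of length [n] contains [U]. *)
pose W := undup U ++ [seq t <- T | t \notin U].
have uW : uniq W.
  rewrite cat_uniq undup_uniq filter_uniq // andbT.
  by apply/hasPn => t; rewrite mem_filter mem_undup => /andP[].
have WT : W =i T.
  move=> t; rewrite mem_cat mem_undup mem_filter.
  by case: (boolP (t \in U)) => //= /UT ->.
have sW : size W = size T by apply/perm_size/uniq_perm.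
exists (take n W); split.
- exact: take_uniq.
- by rewrite size_takel // sW.
- move=> t tU; rewrite take_cat ltnNge (leq_trans (size_undup U) Un) /=.
  by rewrite mem_cat mem_undup tU.
- by move=> t /mem_take; rewrite WT.
Qed.

Lemma Tdim_le k n : (0 < k <= n)%N -> (exists X, @Tdim R M n X) ->
  exists X, @Tdim R M k X.
Proof.
move=> /andP[k0 kn] [_ /TdimP[_ [T [uT sT iT _]]]].
have [//||V [uV sV _ VT]] := @subset_of_size [::] T k uT.
  by rewrite sT.
exists (Defs.conv [set` V]); apply/TdimP; split=> //; exists V; split => //.
exact: independent_sub iT.
Qed.

Hypothesis hM : metric_tree M.

Lemma segment_hull_sub_conv T : segment_hull T `<=` Defs.conv [set` T].
Proof.
move=> p [a [b [aT bT apb]]] C [Cconv TC].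
by apply: (Cconv a b); [exact: TC|exact: TC|apply/segP].
Qed.

Lemma conv_sub_segment_hull S T :
  [set` S] `<=` segment_hull T -> Defs.conv [set` S] `<=` Defs.conv [set` T].
Proof.
move=> ST p pS C [Cconv TC]; apply: pS; split=> // q /ST /segment_hull_sub_conv.
by apply.
Qed.

(* If some [t] lies between [x] and another [t'], then it separates [x] from
   all of [T], so that [x] can replace [t]. *)
Lemma independent_absorb T x : uniq T -> independent T -> (1 < size T)%N ->
  exists T', [/\ uniq T', independent T', (size T <= size T')%N,
                 segment_hull T `<=` segment_hull T' & segment_hull T' x].
Proof.
move=> uT iT sT; have [xT|xT] := pselect (segment_hull T x).
  by exists T; split.
have xneq t : t \in T -> x != t.
  by move=> tT; apply/eqP => xt; apply: xT; rewrite xt; exact: mem_segment_hull.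
have xNT : x \notin T by apply/negP => /mem_segment_hull.
have [[t [t' [tT t'T tt' xtt']]]|nsep] := pselect (exists t t',
    [/\ t \in T, t' \in T, t != t' & between x t t']); last first.
  exists (x :: T); split => //.
  - by rewrite /= xNT.
  - have nb b c : b \in T -> c \in T -> b != c -> ~ between x b c.
      by move=> bT cT bc xbc; apply: nsep; exists b, c.
    move=> a b c; rewrite !inE.
    move=> /predU1P[->|aT] /predU1P[->|bT] /predU1P[->|cT]; rewrite ?eqxx //.
    + by move=> _ bc _; exact: nb.
    + by move=> _ _ _ axc; apply: xT; exists a, c.
    + by move=> ab bx _ /between_sym; apply: nb => //; rewrite eq_sym.
    + exact: iT.
  - by apply: segment_hullS => y yT; rewrite inE yT orbT.
  - by apply: mem_segment_hull; rewrite mem_head.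
(* By the tripod property [t] lies on [[x, u]] or on [[t', u]]; the latter contradicts independence
   of [T]. *)
have sep u : u \in T -> u != t -> between x t u.
  move=> uinT ut; have [<-//|t'u] := eqVneq t' u.
  case: (between_tripod hM u xtt') => // t'tu.
  by case: (iT t' t u) => //; rewrite eq_sym.
have sepd u : u \in T -> u != t -> mdist x u = mdist x t + mdist t u.
  exact: sep.
have memT' u : (u \in x :: rem t T) = (u == x) || (u != t) && (u \in T).
  by rewrite inE mem_rem_uniq // inE.
have xt0 : 0 < mdist x t by rewrite mdist_gt0 xneq.
have toT' u : u \in T -> u != t -> u \in x :: rem t T.
  by move=> uinT ut; rewrite memT' ut uinT orbT.
have xT' : x \in x :: rem t T by rewrite mem_head.
exists (x :: rem t T); split => //.
- by rewrite /= rem_uniq // andbT; apply: contra xNT; exact: mem_rem.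
- have nb b c : b \in T -> b != t -> c \in T -> c != t -> b != c ->
      ~ between x b c.
    move=> bT bt cT ct bc; rewrite /between (sepd b) // (sepd c) // => e.
    case: (iT t b c) => //; first by rewrite eq_sym.
      by rewrite eq_sym.
    by rewrite /between; lra.
  move=> a b c; rewrite !memT'.
  move=> /predU1P[->|/andP[at_ aT]] /predU1P[->|/andP[bt bT]]
    /predU1P[->|/andP[ct cT]]; rewrite ?eqxx //.
  + by move=> _ bc _; exact: nb.
  (* The way from [a] to [c] through [x] exceeds the one through [t] by twice [mdist x t], which is
     positive. *)
  + move=> _ _ _; rewrite /between (metric_sym a x) (sepd a) // (sepd c) //.
    by have := metric_triangle a t c; rewrite (metric_sym a t); lra.
  + by move=> ab bx _ /between_sym; apply: nb => //; rewrite eq_sym.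
  + exact: iT.
- by rewrite /= size_rem // prednK // ltnW.
- have t'T' : t' \in x :: rem t T by apply: toT' => //; rewrite eq_sym.
  move=> p [a [b [aT bT apb]]].
  (* Segments ending at the removed [t] survive: [[t, c]] is part of [[x, c]], and [t] itself lies
     on [[x, t']]. *)
  have tcase c : c \in T -> between t p c -> segment_hull (x :: rem t T) p.
    move=> cT; have [->|ct] := eqVneq c t.
      by move=> /between_same ->; exists x, t'.
    move=> tpc; exists x, c; split; [by []|exact: toT'|].
    by apply/between_sym/(between_trans (between_sym (sep _ cT ct)))/between_sym.
  have [e|at_] := eqVneq a t; first by apply: (tcase b) => //; rewrite -e.
  have [e|bt] := eqVneq b t.
    by apply: (tcase a) => //; rewrite -e; exact: between_sym.
  by exists a, b; split => //; exact: toT'.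
- exact: mem_segment_hull.
Qed.

Lemma independent_absorb_seq S T : uniq T -> independent T -> (1 < size T)%N ->
  exists T', [/\ uniq T', independent T', (size T <= size T')%N &
                 [set` S] `<=` segment_hull T'].
Proof.
move=> uT iT sT; elim: S => [|x S [T1 [uT1 iT1 sT1 ST1]]].
  by exists T; split => // y.
have [T2 [uT2 iT2 sT2 T12 xT2]] :=
  independent_absorb x uT1 iT1 (leq_trans sT sT1).
exists T2; split => //; first exact: leq_trans sT2.
by move=> y /=; rewrite inE => /predU1P[->//|/ST1/T12].
Qed.

Lemma segment_hull_root T t0 p : t0 \in T -> segment_hull T p ->
  exists2 t, t \in T & between t0 p t.
Proof.
move=> t0T [a [b [aT bT apb]]].
by case: (between_tripod hM t0 apb) => /between_sym; [exists a|exists b].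
Qed.

Lemma segment_hull_small S T : (0 < size T)%N ->
  [set` S] `<=` segment_hull T ->
  exists U, [/\ {subset U <= T}, (size U <= (size S).+1)%N &
                [set` S] `<=` segment_hull U].
Proof.
case: T => // t0 T' _; set T := t0 :: T' => ST.
have t0T : t0 \in T by rewrite mem_head.
suff [L [LT sL SL]] : exists L, [/\ {subset L <= T}, size L = size S &
    forall p, p \in S -> exists2 t, t \in L & between t0 p t].
  exists (t0 :: L); split.
  - by move=> t; rewrite inE => /predU1P[->//|/LT].
  - by rewrite /= sL.
  - move=> p /SL[t tL t0pt]; exists t0, t; split=> //; first exact: mem_head.
    by rewrite inE tL orbT.
elim: S ST => [_|x S IH xST]; first by exists [::].
have [|L [LT sL SL]] := IH.
  by move=> y yS; apply: xST; rewrite /= inE yS orbT.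
have [|t tT xt] := @segment_hull_root T t0 x t0T; first exact/xST/mem_head.
exists (t :: L); split => [u||p].
- by rewrite inE => /predU1P[->//|/LT].
- by rewrite /= sL.
- rewrite inE => /predU1P[->|/SL[u uL pu]]; first by exists t; rewrite ?mem_head.
  by exists u; rewrite // inE uL orbT.
Qed.

Lemma Tdim_enlarge m n X : (m < n)%N -> Tdim m X -> (exists Y, @Tdim R M n Y) ->
  exists2 Y, Tdim n Y & X `<=` Y.
Proof.
move=> mn /TdimP[m0 [S [_ sS _ ->]]] [_ /TdimP[n0 [T0 [uT0 sT0 iT0 _]]]].
have [|T [uT iT sT ST]] := independent_absorb_seq S uT0 iT0.
  by rewrite sT0 (leq_trans _ mn).
have [|U [UT sU SU]] := segment_hull_small _ ST.
  by rewrite (leq_trans _ sT) // sT0.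
(* The sizes fit: [size U <= m + 1 <= n <= size T]. *)
have [|V [uV sV UV VT]] := @subset_of_size U T n uT UT.
  by rewrite -sT0 sT (leq_trans sU) // sS sT0.
exists (Defs.conv [set` V]).
  apply/TdimP; split=> //; exists V; split=> //; exact: independent_sub iT.
apply: conv_sub_segment_hull => p /SU; exact: segment_hullS.
Qed.

End Independence.

(** * Monotonicity of the widths and the convention beyond the T*-dimension *)

Section Widths.
Set Implicit Arguments.
Unset Strict Implicit.
Import Order.TTheory.
Context {R : realType} {M : metricType R}.
Implicit Types (A B X Y : set M) (n m k : nat).

Lemma le_deviationl A B X : A `<=` B -> (deviation A X <= deviation B X)%E.
Proof.
by move=> AB; apply: le_max2 => //; apply/ereal_sup_le/image_subset.
Qed.

Lemma le_deviationr A X Y : X `<=` Y -> (deviation A Y <= deviation A X)%E.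
Proof.
move=> XY; apply: le_max2 => //; apply/ereal_supP => _ [a Aa <-].
apply: (@le_trans _ _ (pt_dist a X)); last by apply: ereal_sup_ubound; exists a.
exact/ereal_inf_le_tmp/image_subset.
Qed.

Lemma le_raw_Twidth n A B :
  A `<=` B -> (raw_Twidth n A <= raw_Twidth n B)%E.
Proof.
move=> AB; apply/ereal_infP => _ [X nX <-].
apply: le_trans (le_deviationl X AB).
by apply: ereal_inf_lbound; exists X.
Qed.

Lemma raw_Twidth_nonincreasing m n A : metric_tree M -> (m <= n)%N ->
  (exists X, @Tdim R M n X) -> (raw_Twidth n A <= raw_Twidth m A)%E.
Proof.
move=> hM mn exn; apply/ereal_infP => _ [X mX <-].
have [Y nY XY] : exists2 Y, Tdim n Y & X `<=` Y.
  move: mn; rewrite leq_eqVlt => /predU1P[<-|mn]; first by exists X.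
  exact: (Tdim_enlarge hM mn mX).
apply: le_trans (le_deviationr A XY).
by apply: ereal_inf_lbound; exists Y.
Qed.

Lemma raw_Twidth_empty n A : ~ (exists X, @Tdim R M n X) ->
  raw_Twidth n A = +oo%E.
Proof.
move=> nex; rewrite /raw_Twidth -[RHS](@ereal_inf0 R); congr ereal_inf.
by rewrite -subset0 => _ [X nX <-]; apply: nex; exists X.
Qed.

Lemma Twidth_Tstardim n k A : (n < k)%N -> Tstardim n [set: M] ->
  Twidth k A = raw_Twidth n A.
Proof.
move=> nk hn; rewrite /Twidth; congr raw_Twidth.
by apply: xget_unique => // p [_ hp]; exact: Tstardim_uniq hp hn.
Qed.

Lemma Twidth_raw k A : (forall n, (n < k)%N -> ~ Tstardim n [set: M]) ->
  Twidth k A = raw_Twidth k A.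
Proof.
move=> nk; rewrite /Twidth; congr raw_Twidth.
by apply: xgetPN => n [/nk].
Qed.

(** By [Tdim_le] a dimension above [n] would yield dimension [n], so the attained dimensions are
    bounded; their maximum is [p]. *)
Lemma exists_Tstardim m n : (exists X, @Tdim R M m X) ->
  ~ (exists X, @Tdim R M n X) -> (m <= n)%N ->
  exists2 p, (p < n)%N & Tstardim p [set: M].
Proof.
move=> exm nexn mn.
have m0 : (0 < m)%N by case: exm => X [].
pose P k := `[< exists X, @Tdim R M k X >].
have bound k : P k -> (k <= n)%N.
  move=> /asboolP exk; rewrite leqNgt; apply/negP => nk; apply: nexn.
  by apply: Tdim_le exk; rewrite (leq_trans m0 mn) ltnW.
have exP : exists k, P k by exists m; apply/asboolP.
case: (ex_maxnP exP bound) => p Pp pmax; exists p.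
  rewrite ltn_neqAle bound // andbT; apply/eqP => pn.
  by apply: nexn; rewrite -pn; apply/asboolP.
split; first by move/asboolP: Pp => [X pX]; exists X.
move=> k pk [X [_ kX]]; have /pmax : P k by apply/asboolP; exists X.
by rewrite leqNgt pk.
Qed.

End Widths.

Theorem proposition2p12 (R : realType) (M : metricType R) (hM : metric_tree M)
    (A B : set M) (hAB : A `<=` B) :
  (forall n : nat, (0 < n)%N -> (Twidth n A <= Twidth n B)%E) /\
  (forall m n : nat, (0 < m)%N -> (m <= n)%N -> (Twidth n A <= Twidth m A)%E).
Proof.
(* The index selected by [Twidth] depends on [n] and [M] only, hence is the same for [A] and [B]. *)
split=> [n _|m n m0 mn]; first exact: le_raw_Twidth.
have [[p pn hp]|noT] :=
    pselect (exists2 p, (p < n)%N & Tstardim p [set: M]).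
  rewrite (Twidth_Tstardim A pn hp); have [pm|mp] := ltnP p m.
    by rewrite (Twidth_Tstardim A pm hp).
  (* Now [m <= p]: uniqueness of [p] excludes the convention at [m], and the comparison is between
     [m] and [p]. *)
  rewrite Twidth_raw => [|q qm hq]; last first.
    by move: (leq_trans qm mp); rewrite (Tstardim_uniq hq hp) ltnn.
  by apply: raw_Twidth_nonincreasing => //; case: hp => -[X [_ pX]] _; exists X.
have noT' q : (q < n)%N -> ~ Tstardim q [set: M].
  by move=> qn hq; apply: noT; exists q.
rewrite (Twidth_raw A noT') Twidth_raw => [|q qm]; last first.
  exact/noT'/(leq_trans qm).
have [exn|nexn] := pselect (exists X, @Tdim R M n X).
  exact: raw_Twidth_nonincreasing.
(* Without sets of dimension [n], one of dimension [m] would give a T*-dimension below [n]; so the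
   width at [m] is an infimum over the empty set, [+oo]. *)
rewrite (@raw_Twidth_empty _ _ m) ?leey // => exm; apply: noT.
exact: exists_Tstardim exm nexn mn.
Qed.
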